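(* Let $K\ge 2$ be an integer, let $\boldsymbol{\alpha}=(\alpha_1,\dots,\alpha_K)$ with $\alpha_k\ge 1$ for all $k$ (equivalently $\alpha_k=e_k+1$ with evidence $e_k\ge 0$), let $S=\sum_{k=1}^K\alpha_k$, and let $\mathbf p\sim\mathrm{Dir}(\boldsymbol\alpha)$, $y\mid\mathbf p\sim\mathrm{Cat}(\mathbf p)$. With the uncertainty measures $u_v,u_{diss},u_{alea},u_{epis},u_{en}$ defined in the context, the following hold. 1. For every such $\boldsymbol\alpha$: (a) $u_v+u_{diss}\le 1$; (b) $u_v>u_{epis}$. 2. (a) If $\boldsymbol\alpha=(1,\dots,1)$, then $1=u_v=u_{en}>u_{alea}>u_{epis}>u_{diss}=0$. (b) If $\alpha_1=\alpha_2=\cdots=\alpha_K$, then $u_{en}=1$, and as $S\to\infty$ we have $u_{diss}\to 1$, $u_{alea}\to 1$, $u_v\to 0$, $u_{epis}\to 0$; moreover, for all sufficiently large $S$, $u_{en}>u_{alea}>u_{diss}>u_v>u_{epis}$.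
   Context: Subjective-logic opinion associated with $\boldsymbol\alpha$ (base rates $1/K$, non-informative weight $W=K$): belief masses $b_k=(\alpha_k-1)/S$ and vacuity $u_v=K/S$, so $\sum_k b_k+u_v=1$. Dissonance: $u_{diss}=\sum_{k=1}^K \frac{b_k\sum_{j\ne k} b_j\,\mathrm{Bal}(b_j,b_k)}{\sum_{j\ne k} b_j}$, where $\mathrm{Bal}(b_j,b_k)=1-\frac{|b_j-b_k|}{b_j+b_k}$ if $b_jb_k\neq 0$ and $\mathrm{Bal}(b_j,b_k)=0$ if $\min(b_j,b_k)=0$; a summand whose denominator $\sum_{j\ne k}b_j$ is $0$ is taken to be $0$. Let $H_K(\mathbf q)=-\sum_{k=1}^K q_k\log_K q_k$ (entropy with logarithm base $K$). Entropy: $u_{en}=H_K(\mathbb E[\mathbf p])$ where $\mathbb E[\mathbf p]=\boldsymbol\alpha/S$. Aleatoric uncertainty: $u_{alea}=\mathbb E_{\mathbf p\sim\mathrm{Dir}(\boldsymbol\alpha)}[H_K(\mathbf p)]$. Epistemic uncertainty (mutual information between $y$ and $\mathbf p$): $u_{epis}=u_{en}-u_{alea}$. *)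

(* Defs.v *)
From HB Require Import structures.
From mathcomp Require Import all_boot all_order all_algebra.
From mathcomp Require Import all_classical all_reals all_analysis.
Set Implicit Arguments. Unset Strict Implicit. Unset Printing Implicit Defensive.
Import Order.TTheory GRing.Theory Num.Theory.
Import numFieldNormedType.Exports.
Local Open Scope classical_set_scope.
Local Open Scope ring_scope.

Section Uncertainty.
Variables (R : realType) (K : nat).
Implicit Types (alpha q : 'I_K -> R).

Definition strength alpha : R := \sum_(k < K) alpha k.

Definition belief alpha (k : 'I_K) : R := (alpha k - 1) / strength alpha.
Definition u_v alpha : R := K%:R / strength alpha.

Definition Bal (bj bk : R) : R :=
  if (bj == 0) || (bk == 0) then 0 else 1 - `|bj - bk| / (bj + bk).

Definition u_diss alpha : R :=
  \sum_(k < K)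
    let den := \sum_(j < K | j != k) belief alpha j in
    if den == 0 then 0
    else belief alpha k *
         (\sum_(j < K | j != k) belief alpha j * Bal (belief alpha j) (belief alpha k))
         / den.

(** entropy with logarithm base K (convention 0 log 0 = 0 via 0 * _ = 0) *)
Definition H_K q : R := - \sum_(k < K) q k * (ln (q k) / ln K%:R).

(** entropy of the expected categorical distribution E[p] = alpha / S *)
Definition u_en alpha : R := H_K (fun k => alpha k / strength alpha).

(** Integration over the probability simplex.
    [simplex_int n g r] integrates g over sequences [x_0; ...; x_n] with
    x_i >= 0 and sum x_i = r, with respect to Lebesgue measure on the first n
    (free) coordinates, the last coordinate being x_n = r - x_0 - ... - x_{n-1}. *)
Fixpoint simplex_int (n : nat) (g : seq R -> R) (r : R) : R :=
  match n with
  | O => g [:: r]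
  | n'.+1 => Rintegral (@lebesgue_measure R) `[0, r]
               (fun x => simplex_int n' (fun s => g (x :: s)) (r - x))
  end.

Definition vec_of_seq (s : seq R) : 'I_K -> R := fun k => nth 0 s k.

Definition dir_dens alpha (p : 'I_K -> R) : R :=
  \prod_(k < K) (p k) `^ (alpha k - 1).

Definition dir_expect alpha (f : ('I_K -> R) -> R) : R :=
  simplex_int K.-1 (fun s => f (vec_of_seq s) * dir_dens alpha (vec_of_seq s)) 1
  / simplex_int K.-1 (fun s => dir_dens alpha (vec_of_seq s)) 1.

Definition u_alea alpha : R := dir_expect alpha H_K.
Definition u_epis alpha : R := u_en alpha - u_alea alpha.

Definition equal_alpha (S : R) : 'I_K -> R := fun _ => S / K%:R.

End Uncertainty.

(* Main.v *)
(** With [m = alpha / S], the epistemic uncertainty is [E[KL(p || m)] / ln K].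
    From [ln t <= t - 1] one gets, for [p, m] in the unit interval,
    [p - m + (p - m)^2 / 4 <= p ln (p / m) <= p^2 / m - p].  Summed and
    integrated, these bounds only involve the first two moments of the Dirichlet
    distribution: since its coordinates have positive variance,
    [0 < u_epis <= (K - 1) / ((S + 1) ln K)].  Now [ln K >= 1 - 1 / K] gives
    [u_epis < K / S = u_v], and [ln K > 2 (K - 1) / (K + 1)] gives
    [u_epis < 1 / 2] when all the [alpha_k] are [1].  The moments follow from
    [a B(a, b + 1) = b B(a + 1, b)], i.e. from integrating the derivative of
    [x^a (1 - x)^b], and from the scaling of the convolution of two powers. *)

Require Import Defs.
From HB Require Import structures.
From mathcomp Require Import all_boot all_order all_algebra.
From mathcomp Require Import all_classical all_reals all_analysis.
From mathcomp Require Import measurable_realfun ring lra.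
Import Order.TTheory GRing.Theory Num.Theory.
Import numFieldNormedType.Exports.
Local Open Scope classical_set_scope.
Local Open Scope ring_scope.

(** * Linearity and monotonicity of the iterated simplex integral *)

Section SimplexIntegral.
#[local] Set Implicit Arguments.
#[local] Unset Strict Implicit.
Variable R : realType.
Implicit Types (f h : R -> R) (g : seq R -> R) (r x : R) (n : nat).
Local Notation mu := (@lebesgue_measure R).

(** Nonnegativity is asked at every index: past the end [nth] returns the default 0, so no bound on
    [i] has to be tracked when an entry is added in front. *)
Definition in_simplex n r (s : seq R) :=
  [/\ size s = n.+1, (forall i, 0 <= nth 0 s i) & \sum_(x <- s) x = r].

Lemma in_simplexS n r x s : 0 <= x -> in_simplex n (r - x) s ->
  in_simplex n.+1 r (x :: s).
Proof.
move=> x0 [ss s0 sr]; split => /=; first by rewrite ss.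
- by case.
- by rewrite big_cons sr; ring.
Qed.

(* Without integrability at every level of the iterated integral, [Rintegral]
   takes junk values and [simplex_int] is neither linear nor monotone. *)
Fixpoint simplex_integrable n g r : Prop :=
  match n with
  | O => True
  | n'.+1 =>
      (forall x, 0 <= x <= r ->
         simplex_integrable n' (fun s => g (x :: s)) (r - x)) /\
      mu.-integrable `[0, r]
        (EFin \o fun x => simplex_int n' (fun s => g (x :: s)) (r - x))
  end.

Lemma eq_simplex_int n g1 g2 r : 0 <= r ->
  (forall s, in_simplex n r s -> g1 s = g2 s) ->
  simplex_int n g1 r = simplex_int n g2 r.
Proof.
elim: n g1 g2 r => [|n IH] g1 g2 r r0 g12 /=.
  apply: g12; split => //=; last by rewrite big_seq1.
  by case => //= -[].
apply: eq_Rintegral => x; rewrite inE/= in_itv/= => /andP[x0 xr].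
apply: IH; first by rewrite subr_ge0.
by move=> s sx; apply: g12; exact: in_simplexS.
Qed.

Lemma eq_simplex_integrable n g1 g2 r : 0 <= r ->
  (forall s, in_simplex n r s -> g1 s = g2 s) ->
  simplex_integrable n g1 r -> simplex_integrable n g2 r.
Proof.
elim: n g1 g2 r => [//|n IH] g1 g2 r r0 g12 /= [gi ig].
have sub x s : 0 <= x <= r -> in_simplex n (r - x) s ->
    g1 (x :: s) = g2 (x :: s).
  by case/andP=> x0 xr sx; apply: g12; exact: in_simplexS.
split.
  move=> x x0r; apply: IH (gi x x0r); last by move=> s; exact: sub.
  by case/andP: x0r => _; rewrite subr_ge0.
apply: eq_integrable ig => //.
move=> x; rewrite inE/= in_itv/= => x0r; congr EFin.
apply: eq_simplex_int; last by move=> s; exact: sub.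
by case/andP: x0r => _; rewrite subr_ge0.
Qed.

Lemma simplex_intD n g1 g2 r :
  simplex_integrable n g1 r -> simplex_integrable n g2 r ->
  simplex_integrable n (fun s => g1 s + g2 s) r /\
  simplex_int n (fun s => g1 s + g2 s) r = simplex_int n g1 r + simplex_int n g2 r.
Proof.
elim: n g1 g2 r => [//|n IH] g1 g2 r /= [g1i ig1] [g2i ig2].
have E x : x \in (`[0, r]%classic : set R) ->
    simplex_int n (fun s => g1 (x :: s) + g2 (x :: s)) (r - x) =
    simplex_int n (fun s => g1 (x :: s)) (r - x) +
    simplex_int n (fun s => g2 (x :: s)) (r - x).
  rewrite inE/= in_itv/= => x0r.
  by have [] := IH _ _ _ (g1i _ x0r) (g2i _ x0r).
split; first split.
- by move=> x x0r; have [] := IH _ _ _ (g1i _ x0r) (g2i _ x0r).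
- refine (eq_integrable _ _ _ _ (integrableD _ ig1 ig2)) => //.
  by move=> x xr /=; rewrite E// EFinD.
- by rewrite -RintegralD //; exact: eq_Rintegral.
Qed.

Lemma simplex_intZ n k g r : simplex_integrable n g r ->
  simplex_integrable n (fun s => k * g s) r /\
  simplex_int n (fun s => k * g s) r = k * simplex_int n g r.
Proof.
elim: n g r => [//|n IH] g r /= [gi ig].
have E x : x \in (`[0, r]%classic : set R) ->
    simplex_int n (fun s => k * g (x :: s)) (r - x) =
    k * simplex_int n (fun s => g (x :: s)) (r - x).
  rewrite inE/= in_itv/= => x0r.
  by have [] := IH _ _ (gi _ x0r).
split; first split.
- by move=> x x0r; have [] := IH _ _ (gi _ x0r).
- refine (eq_integrable _ _ _ _ (integrableZl _ k ig)) => //.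
  by move=> x xr /=; rewrite E// EFinM.
- by rewrite -RintegralZl //; exact: eq_Rintegral.
Qed.

Lemma simplex_int0 n r : simplex_integrable n (fun=> 0) r /\
  simplex_int n (fun=> 0 : R) r = 0.
Proof.
elim: n r => [//|n IH] r /=.
have -> : (fun x => simplex_int n (fun=> 0 : R) (r - x)) = fun=> 0.
  by apply/funext => x; have [] := IH (r - x).
split; last by rewrite Rintegral_cst// mul0r.
split; last exact: integrable0.
by move=> x _; have [] := IH (r - x).
Qed.

Lemma simplex_int_sum n (I : Type) (l : seq I) (G : I -> seq R -> R) r :
  (forall i, simplex_integrable n (G i) r) ->
  simplex_integrable n (fun s => \sum_(i <- l) G i s) r /\
  simplex_int n (fun s => \sum_(i <- l) G i s) r =
  \sum_(i <- l) simplex_int n (G i) r.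
Proof.
move=> Gi; elim: l => [|i l [IH1 IH2]].
  have -> : (fun s => \sum_(i <- [::]) G i s) = fun=> 0.
    by apply/funext => s; rewrite big_nil.
  by rewrite big_nil; exact: simplex_int0.
have -> : (fun s => \sum_(j <- i :: l) G j s) =
    fun s => G i s + \sum_(j <- l) G j s.
  by apply/funext => s; rewrite big_cons.
rewrite big_cons -IH2.
exact: simplex_intD.
Qed.

Lemma le_simplex_int n g1 g2 r : 0 <= r ->
  simplex_integrable n g1 r -> simplex_integrable n g2 r ->
  (forall s, in_simplex n r s -> g1 s <= g2 s) ->
  simplex_int n g1 r <= simplex_int n g2 r.
Proof.
elim: n g1 g2 r => [|n IH] g1 g2 r r0 /=.
  move=> _ _; apply; split => //=; last by rewrite big_seq1.
  by case => //= -[].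
move=> [g1i ig1] [g2i ig2] g12; apply: le_Rintegral => //.
move=> x /=; rewrite in_itv/= => /[dup] x0r /andP[x0 xr].
apply: IH; [by rewrite subr_ge0|exact: g1i|exact: g2i|].
by move=> s sx; apply: g12; exact: in_simplexS.
Qed.

End SimplexIntegral.

(** * Convolutions of locally bounded functions and integrals of products *)

Section LocallyBounded.
#[local] Set Implicit Arguments.
#[local] Unset Strict Implicit.
Variable R : realType.
Implicit Types (f h : R -> R) (r x : R) (n : nat).
Local Notation mu := (@lebesgue_measure R).

(** A class stable under products and under convolution over [[0, r]], hence under each layer of the
    iterated integral. It contains the powers with exponent [alpha_k - 1 >= 0]. *)
Definition nonneg_locally_bounded f :=
  [/\ measurable_fun setT f, (forall x, 0 <= f x) &
      forall M, exists B, forall x, 0 <= x <= M -> f x <= B].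

Lemma nonneg_locally_boundedM f h :
  nonneg_locally_bounded f -> nonneg_locally_bounded h ->
  nonneg_locally_bounded (fun x => f x * h x).
Proof.
move=> [mf f0 fB] [mh h0 hB]; split; first exact: measurable_funM.
  by move=> x; exact: mulr_ge0.
move=> M; have [B1 H1] := fB M; have [B2 H2] := hB M.
by exists (B1 * B2) => x x0M; rewrite ler_pM ?H1 ?H2.
Qed.

Lemma integrable_convolution f h r :
  nonneg_locally_bounded f -> nonneg_locally_bounded h ->
  mu.-integrable `[0, r] (EFin \o fun x => f x * h (r - x)).
Proof.
move=> [mf f0 fB] [mh h0 hB]; apply: measurable_bounded_integrable => //.
- by rewrite /= lebesgue_measure_itv/=; case: ifP => _; rewrite -?EFinD ltry.
- apply/measurable_funTS/measurable_funM => //.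
  apply: (measurableT_comp mh); exact: measurable_funB.
- have [B1 H1] := fB r; have [B2 H2] := hB r.
  exists (B1 * B2); split; first exact: num_real.
  move=> M ltM x /=; rewrite in_itv/= => /andP[x0 xr].
  apply: le_trans (ltW ltM); rewrite ger0_norm ?mulr_ge0//.
  rewrite ler_pM ?H1 ?H2 ?x0//; apply/andP; split; first by rewrite subr_ge0.
  by rewrite lerBlDr lerDl.
Qed.

Lemma nonneg_locally_bounded_convolution f h :
  nonneg_locally_bounded f -> nonneg_locally_bounded h ->
  nonneg_locally_bounded
    (fun r => Rintegral mu `[0, r] (fun x => f x * h (r - x))).
Proof.
move=> fP hP; have [mf f0 fB] := fP; have [mh h0 hB] := hP; split.
(* Extending the integrand by 0 off the triangle [0 <= x <= r] makes the domain independent of [r];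
   measurability in [r] is then part of Tonelli's theorem. *)
- pose g (z : R * R) : \bar R :=
    (if (0 <= z.2) && (z.2 <= z.1) then f z.2 * h (z.1 - z.2) else 0)%:E.
  have mg : measurable_fun setT g.
    apply/measurable_EFinP; apply: measurable_fun_ifT => //.
      apply: measurable_and; apply: measurable_fun_ler => //.
    apply: measurable_funM; first exact: measurableT_comp mf measurable_snd.
    by apply: (measurableT_comp mh); exact: measurable_funB.
  have g0 z : (0 <= g z)%E.
    by rewrite lee_fin; case: ifP => // _; rewrite mulr_ge0.
  have := measurable_fun_fubini_tonelli_F (m2 := mu) g mg g0.
  move=> /(measurableT_comp (fine_measurable measurableT)).
  apply: eq_measurable_fun => r _ /=.
  rewrite /fubini_F /Rintegral [in RHS]integral_mkcond; congr fine.
  apply: eq_integral => x _; rewrite /g patchE /=.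
  case: ifPn => [x0r|x0r].
    by rewrite mem_set//= in_itv.
  by rewrite memNset//= in_itv/=; exact/negP.
- by move=> r; apply: Rintegral_ge0 => x _; rewrite mulr_ge0.
- move=> M; have [B1 H1] := fB M; have [B2 H2] := hB M.
  exists (B1 * B2 * M) => r /andP[r0 rM].
  have B1B2 x : 0 <= x <= r -> f x * h (r - x) <= B1 * B2.
    move=> /andP[x0 xr]; rewrite ler_pM ?H1 ?H2 ?x0 ?(le_trans xr)//.
    rewrite subr_ge0 xr/=; apply: le_trans rM; by rewrite lerBlDr lerDl.
  have B0 : 0 <= B1 * B2.
    by apply: le_trans (B1B2 0 _); rewrite ?lexx ?mulr_ge0.
  apply: (@le_trans _ _ (Rintegral mu `[0, r] (cst (B1 * B2)))); last first.
    rewrite Rintegral_cst//= lebesgue_measure_itv/=; case: ifPn => _ /=.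
      by rewrite subr0 ler_wpM2l.
    by rewrite mulr0 mulr_ge0// (le_trans r0 rM).
  apply: le_Rintegral => //; first exact: integrable_convolution.
    apply: measurable_bounded_integrable => //.
      by rewrite /= lebesgue_measure_itv/=; case: ifP => _; rewrite -?EFinD ltry.
    exists (B1 * B2); split; first exact: num_real.
    by move=> M' /ltW ? x _ /=; rewrite ger0_norm.
Qed.

(** The factors are indexed by [nat] so that fixing the first coordinate merely shifts the family to
    [F \o S]. *)
Definition prod_fun n (F : nat -> R -> R) (s : seq R) : R :=
  \prod_(i < n.+1) F i (nth 0 s i).

Lemma prod_fun_cons n F x s :
  prod_fun n.+1 F (x :: s) = F 0%N x * prod_fun n (F \o S) s.
Proof. by rewrite /prod_fun big_ord_recl. Qed.

(** Fixing the first coordinate pulls out the factor [F 0 x], so the integral of a product is an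
    iterated convolution. The induction needs it as a function of [r], since the inner integral is
    taken at [r - x]. *)
Lemma simplex_int_prod n F : (forall i, nonneg_locally_bounded (F i)) ->
  nonneg_locally_bounded (simplex_int n (prod_fun n F)) /\
  forall r, simplex_integrable n (prod_fun n F) r.
Proof.
elim: n F => [|n IH] F FP.
  split=> //; have -> : simplex_int 0 (prod_fun 0 F) = F 0%N; last exact: FP.
  by apply/funext => r; rewrite /= /prod_fun big_ord1.
have [IH1 IH2] := IH _ (fun i => FP i.+1).
have E x r : simplex_integrable n (fun s => prod_fun n.+1 F (x :: s)) r /\
    simplex_int n (fun s => prod_fun n.+1 F (x :: s)) r =
    F 0%N x * simplex_int n (prod_fun n (F \o S)) r.
  have -> : (fun s => prod_fun n.+1 F (x :: s)) =
      fun s => F 0%N x * prod_fun n (F \o S) s.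
    by apply/funext => s; exact: prod_fun_cons.
  exact/simplex_intZ/IH2.
split=> [|r].
  have -> : simplex_int n.+1 (prod_fun n.+1 F) = fun r => Rintegral mu `[0, r]
      (fun x => F 0%N x * simplex_int n (prod_fun n (F \o S)) (r - x)).
    apply/funext => r /=; apply: eq_Rintegral => x _.
    by have [] := E x (r - x).
  exact: nonneg_locally_bounded_convolution.
split=> [x _|]; first by have [] := E x (r - x).
refine (eq_integrable _ _ _ _ (integrable_convolution r (FP 0%N) IH1)) => //.
by move=> x _ /=; have [_ ->] := E x (r - x).
Qed.

End LocallyBounded.

(** * Beta integrals with real parameters and convolutions of powers *)

Section Beta.
#[local] Set Implicit Arguments.
#[local] Unset Strict Implicit.
Variable R : realType.
Implicit Types (a b p r x : R) (n : nat).
Local Notation mu := (@lebesgue_measure R).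

Lemma nonneg_locally_bounded_powR p : 0 <= p ->
  nonneg_locally_bounded (@powR R ^~ p).
Proof.
move=> p0; split; [exact: measurable_powR|by move=> x; exact: powR_ge0|].
move=> M; exists (M `^ p) => x /andP[x0 xM].
by apply: ge0_ler_powR => //; rewrite nnegrE//; exact: le_trans xM.
Qed.

(** The absolute value gives an extension of the power from the half-line that is continuous on the
    whole line, so endpoints need no separate treatment. *)
Lemma continuous_norm_powR p : 0 <= p -> continuous (fun x => `|x| `^ p).
Proof.
rewrite le_eqVlt => /predU1P[<-|p0] x.
  by under eq_fun do rewrite powRr0; exact: cvg_cst.
have [->|x0] := eqVneq x 0; last first.
  apply: (@continuous_comp _ _ _ (fun x => `|x|) (@powR R ^~ p)).
    exact: norm_continuous.
  apply/differentiable_continuous/derivable1_diffP/derivable_powR.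
  by rewrite in_itv/= normr_gt0 x0.
apply/cvgrPdist_lt => /= e e0; rewrite normr0 powR0 ?gt_eqF//.
near=> y; rewrite sub0r normrN ger0_norm ?powR_ge0//.
(* The neighbourhood of 0 that works is [|y| < e ^ (1 / p)]. *)
have -> : e = (e `^ p^-1) `^ p by rewrite -powRrM mulVf ?gt_eqF// powRr1// ltW.
apply: gt0_ltr_powR => //; rewrite ?nnegrE ?powR_ge0//.
by near: y; apply: (@cvgr0_norm_lt _ _ _ _ _ id (@cvg_id _ _)); exact: powR_gt0.
Unshelve. all: by end_near. Qed.

Definition beta a b : R :=
  Rintegral mu `[0, 1] (fun x => x `^ (a - 1) * (1 - x) `^ (b - 1)).

Lemma integrable_beta a b r : 1 <= a -> 1 <= b -> mu.-integrable `[0, r]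
  (EFin \o fun x : R => x `^ (a - 1) * (r - x) `^ (b - 1)).
Proof.
move=> a1 b1.
apply: (@integrable_convolution R (@powR R ^~ (a - 1)) (@powR R ^~ (b - 1)));
  by apply: nonneg_locally_bounded_powR; rewrite subr_ge0.
Qed.

(** The function [x^a (1 - x)^b] vanishes at both ends of the unit interval, so its derivative
    integrates to 0. *)
Lemma betaS a b : 1 <= a -> 1 <= b -> b * beta (a + 1) b = a * beta a (b + 1).
Proof.
move=> a1 b1; have a0 : 0 < a by lra. have b0 : 0 < b by lra.
(* The absolute values make [F] and its derivative candidate [f] continuous everywhere, as the
   fundamental theorem wants; they are removed inside the interval. *)
pose F x : R := `|x| `^ a * `|1 - x| `^ b.
pose f x : R := a * (`|x| `^ (a - 1) * `|1 - x| `^ b)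
             - b * (`|x| `^ a * `|1 - x| `^ (b - 1)).
have cN p : 0 <= p -> continuous (fun x : R => `|1 - x| `^ p).
  move=> p0 x; apply: (@continuous_comp _ _ _ (fun x => 1 - x) (fun x => `|x| `^ p)).
    by apply: cvgB; [exact: cvg_cst|exact: cvg_id].
  exact: continuous_norm_powR.
have cf : continuous f.
  move=> x; apply: cvgB; apply: cvgM; (try exact: cvg_cst);
    apply: cvgM; (try apply: continuous_norm_powR); (try apply: cN); lra.
have dF x : x \in `]0, 1[ -> is_derive x 1 F (f x).
  rewrite in_itv/= => /andP[x0 x1].
  pose f' := x `^ a *: (b * (1 - x) `^ (b - 1) * -1) + (1 - x) `^ b *: (a * x `^ (a - 1)) : R.
  have -> : f x = f'.
    rewrite /f /f' !ger0_norm ?subr_ge0 ?ltW// /GRing.scale/=; ring.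
  apply: (@near_eq_is_derive _ _ _ (fun x => x `^ a * (1 - x) `^ b)) => //.
    near=> y; rewrite /F !ger0_norm//; last first.
      by apply/ltW; near: y; exact: lt_nbhsr.
    by rewrite subr_ge0; apply/ltW; near: y; exact: lt_nbhsl.
  apply: is_deriveM; first exact: is_derive1_powR.
  apply: (@is_derive1_comp _ (@powR R ^~ b) (fun x => 1 - x)).
    by apply: is_derive1_powR; rewrite subr_gt0.
  rewrite -[X in is_derive _ _ _ X]add0r.
  by apply: is_deriveD.
have cF : continuous F.
  by move=> x; apply: cvgM; [apply: continuous_norm_powR|apply: cN]; lra.
have : Rintegral mu `[0, 1] f = F 1 - F 0.
  rewrite /Rintegral (continuous_FTC2 (F := F))//.
  - exact: continuous_subspaceT.
  - split.
    + by move=> x x01; exact: (@ex_derive _ _ _ _ _ _ _ (dF x x01)).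
    + exact/cvg_at_right_filter/cF.
    + exact/cvg_at_left_filter/cF.
  - by move=> x x01; rewrite derive1E; exact: (@derive_val _ _ _ _ _ _ _ (dF x x01)).
have -> : F 1 - F 0 = 0.
  by rewrite /F subrr normr0 !powR0 ?gt_eqF// mulr0 mul0r subrr.
have -> : Rintegral mu `[0, 1] f = a * beta a (b + 1) - b * beta (a + 1) b.
  have a11 : 1 <= a + 1 by lra. have b11 : 1 <= b + 1 by lra.
  rewrite /beta -!RintegralZl ?integrable_beta// -RintegralB//; last 2 first.
  - by refine (integrableZl _ _ (integrable_beta _ _ _)).
  - by refine (integrableZl _ _ (integrable_beta _ _ _)).
  apply: eq_Rintegral => x; rewrite inE/= in_itv/= => /andP[x0 x1].
  by rewrite /f !addrK !ger0_norm ?subr_ge0.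
by move/eqP; rewrite subr_eq0 => /eqP.
Unshelve. all: by end_near. Qed.

(** This is [x + (1 - x) = 1] under the integral. With [betaS] it forms a linear system that
    determines both [beta (a + 1) b] and [beta a (b + 1)]. *)
Lemma betaD a b : 1 <= a -> 1 <= b -> beta (a + 1) b + beta a (b + 1) = beta a b.
Proof.
move=> a1 b1; rewrite /beta -RintegralD//; last 2 first.
- by apply: integrable_beta => //; lra.
- by apply: integrable_beta => //; lra.
apply: eq_Rintegral => x; rewrite inE/= in_itv/= => /andP[x0 x1].
have a0 : 0 < a by lra. have b0 : 0 < b by lra.
have y0 : 0 <= 1 - x by rewrite subr_ge0.
by rewrite !addrK -(mulr_powRB1 x0 a0) -(mulr_powRB1 y0 b0); ring.
Qed.

Lemma betaSl a b : 1 <= a -> 1 <= b -> (a + b) * beta (a + 1) b = a * beta a b.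
Proof.
by move=> a1 b1; rewrite -(betaD a1 b1) mulrDl mulrDr betaS.
Qed.

Lemma betaSr a b : 1 <= a -> 1 <= b -> (a + b) * beta a (b + 1) = b * beta a b.
Proof.
by move=> a1 b1; rewrite -(betaD a1 b1) mulrDl mulrDr -betaS.
Qed.

(** On the unit interval a larger exponent gives a smaller power, so a Beta integral with a large
    integer exponent [N], known to be positive, is a lower bound. *)
Lemma beta_gt0 a b : 1 <= a -> 1 <= b -> 0 < beta a b.
Proof.
move=> a1 b1.
pose N := (Num.trunc (a + b)).+1.
have [aN bN] : a - 1 <= N%:R /\ b - 1 <= N%:R.
  have := @truncnS_gt R (a + b); rewrite -/N; split; lra.
apply: (lt_le_trans (@beta_fun_gt0 R N.+1 N.+1)).
rewrite /beta_fun -Rintegral_mkcond; apply: le_Rintegral => //=.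
- exact: integrable_XMonemX.
- exact: integrable_beta.
move=> x; rewrite in_itv/= => /andP[x0 x1].
rewrite /XMonemX -!powR_mulrn ?subr_ge0//.
have h p (y : R) : p <= N%:R -> 0 <= y <= 1 -> y `^ N%:R <= y `^ p.
  move=> pN /andP[]; rewrite le_eqVlt => /predU1P[<- _|y0 y1].
    by rewrite powR0 ?powR_ge0// pnatr_eq0.
  by apply: ger_powR; rewrite ?y0.
by rewrite ler_pM ?powR_ge0// h// ?subr_ge0 ?x0 ?x1//= lerBlDr lerDl.
Qed.

(** Substituting [x = r t] yields the exponents [a - 1] and [b - 1] of [r], and one more from the
    Jacobian. *)
Lemma convolution_powR a b r : 1 <= a -> 1 <= b -> 0 <= r ->
  Rintegral mu `[0, r] (fun x => x `^ (a - 1) * (r - x) `^ (b - 1)) =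
  beta a b * r `^ (a + b - 1).
Proof.
move=> a1 b1; rewrite le_eqVlt => /predU1P[<-|r0].
  (* At [r = 0] the interval is a point, and the right side vanishes because its exponent
     [a + b - 1] is positive. *)
  rewrite set_itv1 Rintegral_set1 powR0 ?mulr0//; apply/lt0r_neq0; lra.
pose F x := r * x.
pose G x := `|x| `^ (a - 1) * `|r - x| `^ (b - 1).
have dF x : is_derive x 1 F r.
  by rewrite -[r in is_derive _ _ _ r]mulr1; exact: is_deriveZ.
have F' : derive1 F = cst r.
  by apply/funext => x; rewrite derive1E; exact: derive_val.
have cG : continuous G.
  move=> x; apply: cvgM; first by apply: continuous_norm_powR; rewrite subr_ge0.
  apply: (@continuous_comp _ _ _ (fun x => r - x) (fun x => `|x| `^ (b - 1))).
    by apply: cvgB; [exact: cvg_cst|exact: cvg_id].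
  by apply: continuous_norm_powR; rewrite subr_ge0.
transitivity (Rintegral mu `[F 0, F 1] G).
  rewrite /F mulr0 mulr1; apply: eq_Rintegral => x.
  rewrite inE/= in_itv/= => /andP[x0 xr].
  by rewrite /G !ger0_norm ?subr_ge0.
rewrite /Rintegral integration_by_substitution_increasing//; last 6 first.
- by move=> x y _ _; rewrite /F ltr_pM2l.
- by rewrite F' => x _; exact: cvg_cst.
- by rewrite F'; exact: is_cvg_cst.
- by rewrite F'; exact: is_cvg_cst.
- split; first by move=> x _; exact: ex_derive.
  + apply: cvg_at_right_filter; apply: cvgMr; exact: cvg_id.
  + apply: cvg_at_left_filter; apply: cvgMr; exact: cvg_id.
- exact: continuous_subspaceT.
rewrite F' [RHS]mulrC /beta -RintegralZl; [|by []|exact: integrable_beta].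
apply: eq_Rintegral => x; rewrite inE/= in_itv/= => /andP[x0 x1].
have r0' := ltW r0.
have rB : r - r * x = r * (1 - x) by ring.
transitivity (G (r * x) * r); first by [].
rewrite /G rB !ger0_norm ?mulr_ge0 ?subr_ge0//.
rewrite !powRM ?subr_ge0//.
have -> : a + b - 1 = (a - 1) + (b - 1) + 1 by ring.
rewrite (@powRD _ _ (a - 1 + (b - 1)) 1) ?(gt_eqF r0) ?implybT//.
rewrite (@powRD _ _ (a - 1) (b - 1)) ?(gt_eqF r0) ?implybT//.
by rewrite powRr1//; ring.
Qed.

End Beta.

(** * Normalising constant and first two moments of the Dirichlet law *)

Section DirichletMoments.
#[local] Set Implicit Arguments.
#[local] Unset Strict Implicit.
Variable R : realType.
Implicit Types (a : nat -> R) (h : R -> R) (g : seq R -> R) (r x : R) (n k : nat).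

Definition dir_weight n a : seq R -> R :=
  prod_fun n (fun i x => x `^ (a i - 1)).

(** The multivariate Beta function, the product of the [Gamma(a_i)] over [Gamma] of their sum, as
    the telescoping product of Beta values produced by integrating one coordinate at a time. *)
Fixpoint multibeta n a : R :=
  match n with
  | O => 1
  | n'.+1 => beta (a 0%N) (\sum_(i < n'.+1) a i.+1) * multibeta n' (a \o S)
  end.

(** The effect on the parameters of multiplying the Dirichlet weight by its coordinate [k]; moments
    thereby become ratios of normalising constants. *)
Definition incr a k : nat -> R := fun i => a i + (i == k)%:R.

Let sum_ge1 n a : (forall i, 1 <= a i) -> 1 <= \sum_(i < n.+1) a i.
Proof.
move=> a1; rewrite big_ord_recl -[leLHS]addr0 lerD// sumr_ge0// => i _.
exact: le_trans (a1 _).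
Qed.

Lemma incr_ge1 a k : (forall i, 1 <= a i) -> forall i, 1 <= incr a k i.
Proof. by move=> a1 i; rewrite /incr -[leLHS]addr0 lerD. Qed.

Lemma incrS a k : incr a k.+1 \o S = incr (a \o S) k.
Proof. by apply/funext => i; rewrite /incr/= eqSS. Qed.

Lemma incr0S a : incr a 0 \o S = a \o S.
Proof. by apply/funext => i; rewrite /incr/= addr0. Qed.

Lemma sum_incr n a k : (k <= n)%N ->
  \sum_(i < n.+1) incr a k i = \sum_(i < n.+1) a i + 1.
Proof.
move=> kn; rewrite big_split/=; congr (_ + _).
rewrite (bigD1 (Ordinal (kn : (k < n.+1)%N)))//= eqxx big1 ?addr0// => i.
by move/negP => ik; case: eqP => // E; case: ik; apply/eqP/val_inj.
Qed.

Lemma multibeta_gt0 n a : (forall i, 1 <= a i) -> 0 < multibeta n a.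
Proof.
elim: n a => [//|n IH] a a1 /=; rewrite mulr_gt0//.
  by apply: beta_gt0 => //; apply: (@sum_ge1 n (a \o S)) => i; exact: a1.
by apply: IH => i; exact: a1.
Qed.

(** For [k = 0] only the first Beta factor changes. Otherwise its second argument grows by one, and
    the tail sum brought in by [betaSr] is the one that the induction hypothesis absorbs. *)
Lemma multibeta_incr n a k : (forall i, 1 <= a i) -> (k <= n)%N ->
  (\sum_(i < n.+1) a i) * multibeta n (incr a k) = a k * multibeta n a.
Proof.
elim: n a k => [|n IH] a k a1.
  by rewrite leqn0 => /eqP ->; rewrite big_ord1.
have b1 : 1 <= \sum_(i < n.+1) a i.+1 by apply: (@sum_ge1 n (a \o S)) => i; exact: a1.
case: k => [_|k kn]; rewrite big_ord_recl /= mulrA.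
  have -> : \sum_(i < n.+1) incr a 0 i.+1 = \sum_(i < n.+1) a i.+1.
    by apply: eq_bigr => i _; rewrite /incr/= addr0.
  have -> : incr a 0 0 = a 0%N + 1 by rewrite /incr eqxx.
  by rewrite incr0S betaSl// mulrA.
rewrite incrS mulrCA -(IH (a \o S) k)//; last by move=> i; exact: a1.
have -> : \sum_(i < n.+1) incr a k.+1 i.+1 = \sum_(i < n.+1) a i.+1 + 1.
  by rewrite -(@sum_incr n (a \o S) k)//; apply: eq_bigr => i _; rewrite /incr eqSS.
have -> : incr a k.+1 0 = a 0%N by rewrite /incr addr0.
by rewrite betaSr//=; ring.
Qed.

Lemma nonneg_locally_bounded_dir a : (forall i, 1 <= a i) ->
  forall i, nonneg_locally_bounded (fun x : R => x `^ (a i - 1)).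
Proof. by move=> a1 i; apply: nonneg_locally_bounded_powR; rewrite subr_ge0. Qed.

(** A general total [r] is kept because the inner integral is then again a power of [r - x], which
    makes each layer a convolution of two powers. *)
Lemma simplex_int_dir n a r : (forall i, 1 <= a i) -> 0 <= r ->
  simplex_int n (dir_weight n a) r =
  multibeta n a * r `^ (\sum_(i < n.+1) a i - 1).
Proof.
elim: n a r => [|n IH] a r a1 r0.
  by rewrite /= /dir_weight /prod_fun !big_ord1 mul1r.
have aS i : 1 <= (a \o S) i by exact: a1.
have b1 : 1 <= \sum_(i < n.+1) a i.+1 by exact: (@sum_ge1 n (a \o S)).
rewrite big_ord_recl /= mulrAC -convolution_powR// mulrC.
rewrite -RintegralZl//; last exact: integrable_beta.
apply: eq_Rintegral => x; rewrite inE/= in_itv/= => /andP[x0 xr].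
have [] := simplex_intZ (x `^ (a 0%N - 1))
  ((simplex_int_prod n (nonneg_locally_bounded_dir aS)).2 (r - x)).
rewrite -/(dir_weight n (a \o S)) IH ?subr_ge0// => _ E.
rewrite [RHS]mulrCA -E.
by congr simplex_int; apply/funext => s; rewrite /dir_weight prod_fun_cons.
Qed.

Lemma in_simplex_le n r s i : in_simplex n r s -> nth 0 s i <= r.
Proof.
move=> [_ + <-]; elim: s i => [|x s IH] i s0; first by rewrite nth_nil big_nil.
have x0 := s0 0%N; have sS i' : 0 <= nth 0 s i' := s0 i'.+1.
have t0 : 0 <= \sum_(j <- s) j.
  by rewrite (big_nth 0) sumr_ge0.
rewrite big_cons; case: i => [|i] /=; first by rewrite lerDl.
by apply: le_trans (IH i sS) _; rewrite lerDr.
Qed.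

Lemma simplex_integrable_dir n a h k : (forall i, 1 <= a i) -> (k <= n)%N ->
  nonneg_locally_bounded h ->
  forall r, simplex_integrable n (fun s => h (nth 0 s k) * dir_weight n a s) r.
Proof.
move=> a1 kn hP r.
(* Absorbing [h] into the factor of index [k] restores the product form. *)
pose F i x := (if i == k then h x else 1) * x `^ (a i - 1).
have FP i : nonneg_locally_bounded (F i).
  apply: nonneg_locally_boundedM; last exact: nonneg_locally_bounded_dir.
  case: eqP => // _; split => //; by exists 1.
have := (simplex_int_prod n FP).2 r; congr simplex_integrable.
apply/funext => s; rewrite /prod_fun big_split/=; congr (_ * _).
rewrite (bigD1 (Ordinal (kn : (k < n.+1)%N)))//= eqxx big1 ?mulr1// => i.
by move/negP => ik; case: eqP => // E; case: ik; apply/eqP/val_inj.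
Qed.

Lemma dir_weight_incr n a k r s : (forall i, 1 <= a i) -> (k <= n)%N ->
  in_simplex n r s -> nth 0 s k * dir_weight n a s = dir_weight n (incr a k) s.
Proof.
move=> a1 kn [_ s0 _]; rewrite /dir_weight /prod_fun.
(* The rule [x * x ^ (a - 1) = x ^ a] includes [x = 0], since [a k] is positive. *)
rewrite (bigD1 (Ordinal (kn : (k < n.+1)%N)))//= mulrA mulr_powRB1//; last first.
  exact: lt_le_trans (a1 k).
rewrite [RHS](bigD1 (Ordinal (kn : (k < n.+1)%N)))//= /incr eqxx addrK.
congr (_ * _); apply: eq_bigr => i /negP ik.
by case: eqP => [E|_]; [case: ik; apply/eqP/val_inj|rewrite addr0].
Qed.

Definition dirE n a g : R :=
  simplex_int n (fun s => g s * dir_weight n a s) 1 /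
  simplex_int n (dir_weight n a) 1.

Lemma dirE_nth n a k : (forall i, 1 <= a i) -> (k <= n)%N ->
  dirE n a (fun s => nth 0 s k) = a k / \sum_(i < n.+1) a i.
Proof.
move=> a1 kn; rewrite /dirE.
rewrite (@eq_simplex_int _ _ _ (dir_weight n (incr a k)))//; last first.
  by move=> s; exact: dir_weight_incr.
rewrite !simplex_int_dir//; last exact: incr_ge1.
rewrite !powR1 !mulr1.
have S0 : \sum_(i < n.+1) a i != 0.
  by rewrite gt_eqF// (lt_le_trans _ (sum_ge1 n a1)).
apply: (mulfI S0); rewrite mulrA multibeta_incr// mulrCA mulfV// mulr1.
by rewrite mulfK// gt_eqF// multibeta_gt0.
Qed.

Lemma dirE_nth2 n a k : (forall i, 1 <= a i) -> (k <= n)%N ->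
  let S := \sum_(i < n.+1) a i in
  dirE n a (fun s => nth 0 s k ^+ 2) = a k * (a k + 1) / (S * (S + 1)).
Proof.
move=> a1 kn S; rewrite /dirE.
(* The square raises the parameter [k] twice; the second application of the recursion has sum
   [S + 1]. *)
rewrite (@eq_simplex_int _ _ _ (dir_weight n (incr (incr a k) k)))//; last first.
  move=> s sP; rewrite -(dir_weight_incr _ _ sP)//; last exact: incr_ge1.
  by rewrite -(dir_weight_incr _ _ sP)// mulrA expr2.
have i1 := incr_ge1 k a1.
rewrite !simplex_int_dir//; last exact: incr_ge1.
rewrite !powR1 !mulr1.
have S0 : 0 < S by rewrite (lt_le_trans _ (sum_ge1 n a1)).
have := multibeta_incr i1 kn; rewrite sum_incr// -/S => E2.
have := multibeta_incr a1 kn; rewrite -/S => E1.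
have B0 := multibeta_gt0 n a1.
have ikk : incr a k k = a k + 1 by rewrite /incr eqxx.
rewrite ikk in E2.
have : (S * (S + 1)) * multibeta n (incr (incr a k) k) =
    (a k * (a k + 1)) * multibeta n a.
  by rewrite -mulrA E2 mulrCA E1; ring.
move=> E; apply/eqP; rewrite eqr_div; last 2 first.
- exact: lt0r_neq0.
- by apply: lt0r_neq0; rewrite mulr_gt0 ?addr_gt0.
by rewrite mulrC E.
Qed.

End DirichletMoments.

(** * Dirichlet expectations of quadratics and of [x ln x] *)

Section DirichletExpectation.
#[local] Set Implicit Arguments.
#[local] Unset Strict Implicit.
Variables (R : realType) (n : nat) (a : nat -> R).
Hypothesis a_ge1 : forall i, 1 <= a i.
Implicit Types (g : seq R -> R) (s : seq R) (m p x : R).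

Definition dir_integrable g :=
  simplex_integrable n (fun s => g s * dir_weight n a s) 1.

Let W := simplex_int n (dir_weight n a) 1.

Let W_gt0 : 0 < W.
Proof. by rewrite /W simplex_int_dir// powR1 mulr1 multibeta_gt0. Qed.

Lemma dirED g1 g2 : dir_integrable g1 -> dir_integrable g2 ->
  dir_integrable (fun s => g1 s + g2 s) /\
  dirE n a (fun s => g1 s + g2 s) = dirE n a g1 + dirE n a g2.
Proof.
rewrite /dir_integrable /dirE => i1 i2; rewrite -mulrDl.
under eq_fun do rewrite mulrDl.
have [H1 <-] := simplex_intD i1 i2; by split.
Qed.

Lemma dirEZ k g : dir_integrable g ->
  dir_integrable (fun s => k * g s) /\
  dirE n a (fun s => k * g s) = k * dirE n a g.
Proof.
rewrite /dir_integrable /dirE => i1; rewrite mulrA.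
under eq_fun do rewrite -mulrA.
have [H1 <-] := simplex_intZ k i1; by split.
Qed.

Lemma dirE_sum (I : Type) (l : seq I) (G : I -> seq R -> R) :
  (forall i, dir_integrable (G i)) ->
  dir_integrable (fun s => \sum_(i <- l) G i s) /\
  dirE n a (fun s => \sum_(i <- l) G i s) = \sum_(i <- l) dirE n a (G i).
Proof.
rewrite /dir_integrable /dirE => Gi; rewrite -mulr_suml.
under eq_fun do rewrite mulr_suml.
have [H1 <-] := simplex_int_sum l Gi; by split.
Qed.

Lemma eq_dir_integrable g1 g2 : (forall s, in_simplex n 1 s -> g1 s = g2 s) ->
  dir_integrable g1 -> dir_integrable g2.
Proof. by move=> g12; apply: eq_simplex_integrable => // s sP; rewrite g12. Qed.

Lemma le_dirE g1 g2 : dir_integrable g1 -> dir_integrable g2 ->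
  (forall s, in_simplex n 1 s -> g1 s <= g2 s) -> dirE n a g1 <= dirE n a g2.
Proof.
move=> i1 i2 g12; rewrite /dirE ler_pM2r ?invr_gt0//.
apply: le_simplex_int => // s sP; rewrite ler_wpM2r ?g12//.
by apply: prodr_ge0 => i _; exact: powR_ge0.
Qed.

Lemma dirE_cst x : dir_integrable (fun=> x) /\ dirE n a (fun=> x) = x.
Proof.
have i1 := (simplex_int_prod n (nonneg_locally_bounded_dir a_ge1)).2 1.
have [H E] := simplex_intZ x i1; split=> //.
by rewrite /dirE E mulfK// gt_eqF.
Qed.

(** The absolute value secures nonnegativity on the whole line, as the class demands; on the simplex
    it disappears. *)
Lemma nonneg_locally_bounded_exp k : nonneg_locally_bounded (fun x : R => `|x| ^+ k).
Proof.
split; [by apply: measurable_funX|by move=> x; exact: exprn_ge0|].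
move=> M; exists (M ^+ k) => x /andP[x0 xM].
by rewrite ger0_norm// lerXn2r// nnegrE (le_trans x0).
Qed.

Lemma dir_integrable_nthX i k : (i <= n)%N -> dir_integrable (fun s => nth 0 s i ^+ k).
Proof.
move=> ik; have := simplex_integrable_dir a_ge1 ik (nonneg_locally_bounded_exp k) 1.
apply: eq_dir_integrable.
by move=> s [_ s0 _]; rewrite ger0_norm.
Qed.

Lemma nonneg_locally_bounded_xlnx : nonneg_locally_bounded (fun x : R => `|x * ln x|).
Proof.
split => //.
  apply: measurableT_comp => //; apply: measurable_funM => //.
(* Up to 1, [ln (1 / x) <= 1 / x - 1] gives [|x ln x| <= 1 - x]; beyond 1, [ln x <= x] gives at most
   [M ^ 2]. *)
move=> M; exists (1 + M ^+ 2) => x /andP[]; rewrite le_eqVlt => /predU1P[<- M0|x0 xM].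
  by rewrite mul0r normr0 addr_ge0// sqr_ge0.
rewrite normrM (ger0_norm (ltW x0)); have [x1|x1] := leP x 1.
  rewrite ler0_norm ?ln_le0// -lnV//.
  have : ln x^-1 <= x^-1 - 1.
    have -> : x^-1 = 1 + (x^-1 - 1) by ring.
    apply: le_trans (le_ln1Dx _) _; last by lra.
    have : 0 < x^-1 by rewrite invr_gt0.
    lra.
  move=> /(ler_wpM2l (ltW x0)); rewrite mulrBr mulfV ?gt_eqF// => H.
  have := sqr_ge0 M; lra.
rewrite ger0_norm ?ln_ge0 ?ltW//.
have H := ln_sublinear x0; have : x * ln x <= x * x by rewrite ler_pM2l// ltW.
have : x * x <= M ^+ 2 by rewrite expr2 ler_pM// ltW.
lra.
Qed.

Lemma dir_integrable_xlnx i : (i <= n)%N ->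
  dir_integrable (fun s => nth 0 s i * ln (nth 0 s i)).
Proof.
move=> ik.
(* Coordinates on the simplex are at most 1, so [x ln x] is there the opposite of its absolute
   value. *)
have [] := dirEZ (-1) (simplex_integrable_dir a_ge1 ik nonneg_locally_bounded_xlnx 1).
move=> + _; apply: eq_dir_integrable => s sP; have [_ s0 _] := sP.
rewrite ler0_norm ?mulN1r ?opprK//.
by rewrite mulr_ge0_le0 ?ln_le0// (in_simplex_le i sP).
Qed.

Let S := \sum_(i < n.+1) a i.
Let moment2 i := a i * (a i + 1) / (S * (S + 1)).

Lemma dirE_quadratic (A B C : 'I_n.+1 -> R) :
  let g s := \sum_(i < n.+1) (A i * nth 0 s i + B i * nth 0 s i ^+ 2 + C i) in
  dir_integrable g /\
  dirE n a g = \sum_(i < n.+1) (A i * (a i / S) + B i * moment2 i + C i).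
Proof.
have H (i : 'I_n.+1) : let g s := A i * nth 0 s i + B i * nth 0 s i ^+ 2 + C i in
    dir_integrable g /\ dirE n a g = A i * (a i / S) + B i * moment2 i + C i.
  have ik : (i <= n)%N by rewrite -ltnS.
  have [i1 E1] := dirEZ (A i) (dir_integrable_nthX 1 ik).
  have [i2 E2] := dirEZ (B i) (dir_integrable_nthX 2 ik).
  have [i12 E12] := dirED i1 i2.
  have [i3 E3] := dirE_cst (C i).
  have [i4 E4] := dirED i12 i3.
  by split=> //; rewrite E4 E12 E1 E2 E3 dirE_nth// dirE_nth2.
have [H1 H2] := dirE_sum (index_enum 'I_n.+1) (fun i => (H i).1).
by split=> //; rewrite H2; apply: eq_bigr => i _; rewrite (H i).2.
Qed.

(** This is [ln t <= t - 1] at [t = p / m], times [p]. Summed over coordinates, it bounds the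
    Kullback-Leibler divergence by the chi-square one. *)
Lemma xlnx_le m p : 0 <= p -> 0 < m ->
  p * ln p <= (ln m - 1) * p + m^-1 * p ^+ 2.
Proof.
rewrite le_eqVlt => /predU1P[<- m0|p0 m0]; first by rewrite expr0n !mulr0 mul0r addr0.
have := @le_ln1Dx _ (p / m - 1).
have -> : 1 + (p / m - 1) = p / m by ring.
have -> : -1 < p / m - 1 by have : 0 < p / m := divr_gt0 p0 m0; lra.
move=> /(_ isT); rewrite ln_div// => /(ler_wpM2l (ltW p0)).
by rewrite expr2; lra.
Qed.

(* With [p = u^2] and [m = v^2], [ln t <= t - 1] at [t = v / u] leaves the
   Hellinger term [(u - v)^2], and [u + v <= 2]. *)
Lemma xlnx_ge m p : 0 <= p <= 1 -> 0 < m <= 1 ->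
  (ln m + 1) * p - m + (p - m) ^+ 2 / 4 <= p * ln p.
Proof.
move=> /andP[+ p1] /andP[m0 m1].
rewrite le_eqVlt => /predU1P[<-|p0].
  by rewrite !mulr0 mul0r sub0r sqrrN; nra.
have [u [v [u0 v0 up vm]]] : exists u v, [/\ 0 < u, 0 < v, p = u ^+ 2 & m = v ^+ 2].
  exists (Num.sqrt p), (Num.sqrt m); rewrite !sqrtr_gt0.
  by rewrite p0 m0 !sqr_sqrtr ?ltW.
have u1 : u <= 1 by rewrite leNgt; apply/negP => ?; rewrite expr2 in up; nra.
have v1 : v <= 1 by rewrite leNgt; apply/negP => ?; rewrite expr2 in vm; nra.
rewrite up vm !lnXn// ![ln _ *+ 2]mulr2n.
have := @le_ln1Dx _ (v / u - 1).
have -> : 1 + (v / u - 1) = v / u by ring.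
have -> : -1 < v / u - 1 by have : 0 < v / u := divr_gt0 v0 u0; lra.
move=> /(_ isT); rewrite ln_div// => H.
have {H} : u ^+ 2 * (ln v - ln u) <= u * v - u ^+ 2.
  apply: (le_trans (ler_wpM2l (sqr_ge0 u) H)).
  have -> : u ^+ 2 * (v / u - 1) = u * v * (u / u) - u ^+ 2 by ring.
  by rewrite divff ?gt_eqF// mulr1.
have : (u ^+ 2 - v ^+ 2) ^+ 2 / 4 <= (u - v) ^+ 2.
  have -> : (u ^+ 2 - v ^+ 2) ^+ 2 / 4 = (u - v) ^+ 2 * ((u + v) / 2) ^+ 2 by field.
  rewrite ler_piMr ?sqr_ge0// -[leRHS](expr1n _ 2) lerXn2r ?nnegrE; lra.
lra.
Qed.

End DirichletExpectation.

(** * Upper bound and positivity of the epistemic uncertainty *)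

Section EpistemicBounds.
#[local] Set Implicit Arguments.
#[local] Unset Strict Implicit.
Variables (R : realType) (n : nat) (alpha : 'I_n.+1 -> R).
Hypothesis n_gt0 : (0 < n)%N.
Hypothesis alpha_ge1 : forall k, 1 <= alpha k.

(** An extension of [alpha] to [nat]; [inord] only returns values of [alpha], so the lower bound 1
    holds at every index. *)
Let a (i : nat) : R := alpha (inord i).
Let S := strength alpha.
Let m (k : 'I_n.+1) : R := a k / S.
Let N (s : seq R) := \sum_(k < n.+1) nth 0 s k * ln (nth 0 s k).
Let L : R := ln n.+1%:R.

Let a_ge1 i : 1 <= a i. Proof. exact: alpha_ge1. Qed.

Let aE (k : 'I_n.+1) : a k = alpha k. Proof. by rewrite /a inord_val. Qed.

Let sum_a : \sum_(k < n.+1) a k = S.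
Proof. by apply: eq_bigr => k _; rewrite aE. Qed.

Let S_gt0 : 0 < S.
Proof.
rewrite -sum_a big_ord_recl ltr_wpDr ?sumr_ge0// => [i _|].
  exact: le_trans (a_ge1 _).
exact: lt_le_trans (a_ge1 _).
Qed.

(** A second coordinate exists because [0 < n]; strictness is what makes the variances positive. *)
Let a_ltS (k : 'I_n.+1) : a k < S.
Proof.
have [j jk] : exists j : 'I_n.+1, j != k.
  have [->|k0] := eqVneq k ord0; last by exists ord0; rewrite eq_sym.
  by exists ord_max; rewrite -val_eqE/= -lt0n.
rewrite -sum_a (bigD1 k)//= ltrDl (bigD1 j)//= ltr_wpDr ?sumr_ge0// => [i _|].
  exact: le_trans (a_ge1 _).
exact: lt_le_trans (a_ge1 _).
Qed.

Let L_gt0 : 0 < L.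
Proof. by rewrite ln_gt0// ltr1n ltnS. Qed.

Let u_enE : u_en alpha = - L^-1 * \sum_k m k * ln (m k).
Proof.
rewrite /u_en /H_K mulNr mulr_sumr; congr (- _); apply: eq_bigr => k _.
by rewrite /m aE -/S -/L; ring.
Qed.

Let N_integrable : dir_integrable n a N.
Proof.
have i1 (k : 'I_n.+1) := dir_integrable_xlnx a_ge1 (ltn_ord k : (k <= n)%N).
by have [] := dirE_sum (index_enum _) i1.
Qed.

Let u_aleaE : u_alea alpha = - L^-1 * dirE n a N.
Proof.
have [_ <-] := dirEZ (- L^-1) N_integrable.
have wE s : dir_dens alpha (vec_of_seq s) = dir_weight n a s.
  by apply: eq_bigr => k _; rewrite /vec_of_seq aE.
have hE s : H_K (vec_of_seq s : 'I_n.+1 -> R) = - L^-1 * N s.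
  rewrite /H_K mulNr mulr_sumr; congr (- _); apply: eq_bigr => k _.
  by rewrite /vec_of_seq -/L; ring.
rewrite /u_alea /dir_expect /dirE /=.
by congr (_ / _); congr simplex_int; apply/funext => s; rewrite ?wE ?hE.
Qed.

Let u_episE : u_epis alpha = L^-1 * (dirE n a N - \sum_k m k * ln (m k)).
Proof. by rewrite /u_epis u_enE u_aleaE; ring. Qed.

Let m_gt0 k : 0 < m k.
Proof. by rewrite divr_gt0// (lt_le_trans _ (a_ge1 _)). Qed.

Lemma u_epis_le : u_epis alpha <= n%:R / ((S + 1) * L).
Proof.
rewrite u_episE invfM mulrA [leRHS]mulrC ler_pM2l ?invr_gt0//.
pose g s := \sum_(k < n.+1)
  ((ln (m k) - 1) * nth 0 s k + (m k)^-1 * nth 0 s k ^+ 2 + 0).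
have [gi gE] := dirE_quadratic a_ge1 (fun k => ln (m k) - 1)
  (fun k => (m k)^-1) (fun=> 0).
have : dirE n a N <= dirE n a g.
  apply: le_dirE => // s [_ s0 _]; apply: ler_sum => k _.
  by rewrite addr0 xlnx_le.
rewrite gE sum_a => H; rewrite lerBlDl (le_trans H)//.
(* Since [E[p_k^2] / m_k = (a_k + 1) / (S + 1)], the sum is [(S + n + 1) / (S + 1) - 1]. *)
have -> : n%:R / (S + 1) = \sum_(k < n.+1) ((a k + 1) / (S + 1) - m k).
  rewrite sumrB -!mulr_suml big_split/= sum_a sumr_const card_ord.
  by rewrite -natr1; field; rewrite !gt_eqF// addr_gt0.
rewrite -big_split/= ler_sum// => k _; rewrite le_eqVlt; apply/orP; left.
have ak : a k != 0 by rewrite gt_eqF// (lt_le_trans _ (a_ge1 _)).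
(* The logarithm is generalised first, so that unfolding [m] does not reach inside it. *)
apply/eqP; move: (ln (m k)) => l; rewrite /m; field.
by rewrite ak !gt_eqF// addr_gt0.
Qed.

Lemma u_epis_gt0 : 0 < u_epis alpha.
Proof.
rewrite u_episE mulr_gt0 ?invr_gt0// subr_gt0.
(* The lower bound of [xlnx_ge], with its square expanded in powers of the coordinate. *)
pose g s := \sum_(k < n.+1) ((ln (m k) + 1 - m k / 2) * nth 0 s k
  + 4^-1 * nth 0 s k ^+ 2 + (m k ^+ 2 / 4 - m k)).
have [gi gE] := dirE_quadratic a_ge1 (fun k => ln (m k) + 1 - m k / 2)
  (fun=> 4^-1) (fun k => m k ^+ 2 / 4 - m k).
have : dirE n a g <= dirE n a N.
  apply: le_dirE => // s sP; have [_ s0 _] := sP; apply: ler_sum => k _.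
  apply: le_trans (@xlnx_ge _ (m k) (nth 0 s k) _ _).
  - by rewrite le_eqVlt; apply/orP; left; apply/eqP; field.
  - by rewrite s0 (in_simplex_le k sP).
  - by rewrite m_gt0 /m ler_pdivrMr// mul1r ltW.
apply: lt_le_trans; rewrite gE sum_a -subr_gt0 -sumrB.
(* This is a quarter of the variance of [p_k]. *)
have pos (k : 'I_n.+1) : 0 < m k * (S - a k) / (4 * S * (S + 1)).
  have S1 : 0 < S + 1 by rewrite addr_gt0.
  apply: divr_gt0; last by rewrite !mulr_gt0.
  by rewrite mulr_gt0// subr_gt0.
apply: (@lt_le_trans _ _ (\sum_(k < n.+1) (m k * (S - a k) / (4 * S * (S + 1))))).
  by rewrite big_ord_recl ltr_wpDr// sumr_ge0// => k _; exact: ltW.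
rewrite ler_sum// => k _; rewrite le_eqVlt; apply/orP; left.
apply/eqP; move: (ln (m k)) => l; rewrite /m; field.
by rewrite !gt_eqF// addr_gt0.
Qed.

End EpistemicBounds.

(** * Logarithm estimates, vacuity and dissonance *)

Section Measures.
#[local] Set Implicit Arguments.
#[local] Unset Strict Implicit.
Variable R : realType.
Implicit Types (x c : R) (n K : nat).

Lemma ln_ge1BV x : 0 < x -> 1 - x^-1 <= ln x.
Proof.
move=> x0; have x'0 : 0 < x^-1 by rewrite invr_gt0.
have := @le_ln1Dx _ (x^-1 - 1).
have -> : 1 + (x^-1 - 1) = x^-1 by ring.
have -> : -1 < x^-1 - 1 by lra.
by move=> /(_ isT); rewrite lnV//; lra.
Qed.

(** One has [(21 / 20)^14 < 2], while [ln (21 / 20) >= 1 - 20 / 21 = 1 / 21], and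
    [14 / 21 = 2 / 3]. *)
Lemma ln2_gt : 2 / 3 < ln 2 :> R.
Proof.
have q0 : 0 < 21 / 20 :> R by lra.
have : ln ((21 / 20) ^+ 14) < ln 2 :> R.
  by rewrite ltr_ln ?posrE ?exprn_gt0//; lra.
rewrite lnXn// -[ln _ *+ 14]mulr_natl; apply: le_lt_trans.
have := ln_ge1BV q0; rewrite invf_div; lra.
Qed.

(** Induction from [ln2_gt]: with [x = n], the left side grows by [4 / ((x + 2) (x + 3))], the
    logarithm by at least [1 / (x + 2)], and [x >= 1]. *)
Lemma ln_nat_gt n : (0 < n)%N -> 2 * n%:R / (n%:R + 2) < ln n.+1%:R :> R.
Proof.
elim: n => [//|[_ _|n IH _]].
  by apply: le_lt_trans ln2_gt; rewrite le_eqVlt; apply/orP; left; apply/eqP; field.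
have := IH isT; set x : R := n.+1%:R.
have x1 : 1 <= x by rewrite ler1n.
rewrite -(natr1 n.+2) -(natr1 n.+1) -/x => {}IH.
have y0 : 0 < (x + 1 + 1) / (x + 1) by apply: divr_gt0; lra.
have := ln_ge1BV y0; rewrite ln_div ?posrE; [|lra|lra].
rewrite invf_div => H.
have : 2 * (x + 1) / (x + 1 + 2) - 2 * x / (x + 2) <= 1 - (x + 1) / (x + 1 + 1).
  rewrite -subr_ge0.
  have -> : 1 - (x + 1) / (x + 1 + 1) - (2 * (x + 1) / (x + 1 + 2) - 2 * x / (x + 2)) =
     (x - 1) / ((x + 2) * (x + 3)).
    by field; repeat (apply/andP; split); apply/lt0r_neq0; lra.
  by apply: divr_ge0; [lra|apply: mulr_ge0; lra].
lra.
Qed.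

Lemma strength_ge K (alpha : 'I_K -> R) : (forall k, 1 <= alpha k) ->
  K%:R <= strength alpha.
Proof.
move=> a1; have -> : K%:R = \sum_(k < K) (1 : R) by rewrite sumr_const card_ord.
exact: ler_sum.
Qed.

Lemma u_epis_lt_u_v K (alpha : 'I_K -> R) : (2 <= K)%N -> (forall k, 1 <= alpha k) ->
  u_epis alpha < u_v alpha.
Proof.
case: K alpha => [//|n] alpha n0 a1.
have := u_epis_le n0 a1; have := strength_ge a1; rewrite /u_v.
have n1 : 1 <= n%:R :> R by rewrite ler1n.
have := @ln_ge1BV n.+1%:R; rewrite ltr0n => /(_ isT).
rewrite -(natr1 n); set S := strength alpha; set L := ln _; set x : R := n%:R in n1 *.
move=> HL xS H; apply: (le_lt_trans H).
have S0 : 0 < S by lra.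
have HL' : x / (x + 1) <= L.
  by apply: le_trans HL; rewrite le_eqVlt; apply/orP; left; apply/eqP; field; apply/lt0r_neq0; lra.
have x'0 : 0 < x / (x + 1) by apply: divr_gt0; lra.
have L0 : 0 < L by exact: lt_le_trans HL'.
(* The intermediate value is [K / (S + 1)]: it is reached through [L >= x / (x + 1)], and
   [S < S + 1] gives strictness. *)
apply: (@le_lt_trans _ _ ((x + 1) / (S + 1))); last first.
  by rewrite ltr_pM2l ?ltf_pV2 ?posrE; lra.
rewrite invfM mulrA mulrAC ler_pM2r ?invr_gt0; last lra.
by rewrite ler_pdivrMr// -ler_pdivrMl; [rewrite mulrC|lra].
Qed.

Lemma u_vD_belief K (alpha : 'I_K -> R) : 0 < strength alpha ->
  u_v alpha + \sum_(k < K) belief alpha k = 1.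
Proof.
move=> S0; rewrite /belief -mulr_suml sumrB sumr_const card_ord -/(strength alpha).
by rewrite /u_v; field; exact: lt0r_neq0.
Qed.

(** Vacuity and beliefs sum to 1, and each dissonance summand is at most [b_k]: it is 0, or [b_k]
    times a weighted average of balances, which are at most 1. *)
Lemma u_vD_u_diss K (alpha : 'I_K -> R) : (0 < K)%N -> (forall k, 1 <= alpha k) ->
  u_v alpha + u_diss alpha <= 1.
Proof.
move=> K0 a1; have S0 : 0 < strength alpha.
  by apply: lt_le_trans (strength_ge a1); rewrite ltr0n.
have b0 k : 0 <= belief alpha k.
  by rewrite divr_ge0 ?subr_ge0// ltW.
rewrite -(u_vD_belief S0) lerD2l; apply: ler_sum => k _ /=.
set den := \sum_(_ < _ | _) _; case: eqVneq => [//|den0].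
have den_gt0 : 0 < den by rewrite lt_def den0 sumr_ge0.
rewrite -mulrA ler_piMr// ler_pdivrMr// mul1r.
apply: ler_sum => j _; rewrite ler_piMr// /Bal; case: ifP => // _.
by rewrite gerBl divr_ge0// addr_ge0.
Qed.

Lemma strength_cst K c : strength (fun _ : 'I_K => c) = K%:R * c.
Proof. by rewrite /strength sumr_const card_ord mulr_natl. Qed.

Lemma u_en_cst K c : (2 <= K)%N -> 0 < c -> u_en (fun _ : 'I_K => c) = 1.
Proof.
move=> K2 c0; have K0 : 0 < K%:R :> R by rewrite ltr0n (ltnW K2).
rewrite /u_en strength_cst /H_K sumr_const card_ord.
have -> : c / (K%:R * c) = K%:R^-1 by field; rewrite !lt0r_neq0.
have L0 : 0 < ln K%:R :> R by rewrite ln_gt0// ltr1n.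
rewrite lnV// -[_ *+ K]mulr_natl; field.
by rewrite !lt0r_neq0.
Qed.

(** All beliefs vanish, so every summand falls under the zero-denominator convention. *)
Lemma u_diss_one K : u_diss (fun _ : 'I_K => 1 : R) = 0.
Proof.
by rewrite /u_diss big1// => k _; rewrite /= big1 ?eqxx// /belief => *; rewrite subrr mul0r.
Qed.

(** The beliefs share a value [b], positive as [K < S]; all balances are then 1, each summand is
    [b], and the total is [1 - u_v]. *)
Lemma u_diss_equal K (S : R) : (2 <= K)%N -> K%:R < S ->
  u_diss (@equal_alpha R K S) = 1 - K%:R / S.
Proof.
move=> K2 KS; have K0 : 0 < K%:R :> R by rewrite ltr0n (ltnW K2).
have S0 : 0 < S := lt_trans K0 KS.
have SE : strength (@equal_alpha R K S) = S.
  by rewrite strength_cst mulrC divfK ?gt_eqF.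
have E := @u_vD_belief _ (@equal_alpha R K S); rewrite SE /u_v SE in E.
rewrite -[X in _ = X - _](E S0) addrAC subrr add0r.
pose b : R := (S / K%:R - 1) / S.
have b0 : 0 < b by rewrite divr_gt0// subr_gt0 ltr_pdivlMr// mul1r.
have bE k : belief (@equal_alpha R K S) k = b by rewrite /belief SE.
apply: eq_bigr => k _; rewrite /= bE.
have BE : Bal b b = 1 by rewrite /Bal gt_eqF//= subrr normr0 mul0r subr0.
under eq_bigr => j _ do rewrite bE.
under [X in b * X]eq_bigr => j _ do rewrite bE BE mulr1.
case: eqVneq => [d0|d0]; last by rewrite mulfK.
have : 0 < \sum_(j < K | j != k) b.
  have [j jk] : exists j : 'I_K, j != k.
    have [K0' K1'] : (0 < K)%N /\ (1 < K)%N by rewrite (ltnW K2).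
    have [->|k0] := eqVneq k (Ordinal K0'); first by exists (Ordinal K1').
    by exists (Ordinal K0'); rewrite eq_sym.
  by rewrite (bigD1 j)//= ltr_wpDr// sumr_ge0// => *; exact: ltW.
by rewrite d0 ltxx.
Qed.

End Measures.

(** * Equal parameters: limits and ordering for large strength *)

Section EqualEvidence.
#[local] Set Implicit Arguments.
#[local] Unset Strict Implicit.
Variables (R : realType) (K : nat).
Hypothesis K_ge2 : (2 <= K)%N.
Let K_gt0 : 0 < K%:R :> R. Proof. by rewrite ltr0n (ltnW K_ge2). Qed.
Local Notation eqa S := (@equal_alpha R K S).

Lemma equal_alpha_ge1 S : K%:R <= S -> forall k, 1 <= eqa S k.
Proof. by move=> KS k; rewrite /equal_alpha ler_pdivlMr// mul1r. Qed.

Lemma u_v_equal S : u_v (eqa S) = K%:R / S.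
Proof. by rewrite /u_v strength_cst (mulrC _ (S / K%:R)) divfK ?gt_eqF. Qed.

Lemma u_en_equal S : K%:R <= S -> u_en (eqa S) = 1.
Proof. by move=> KS; apply: u_en_cst => //; rewrite divr_gt0// (lt_le_trans K_gt0). Qed.

Lemma u_epis_equal S : K%:R <= S -> 0 < u_epis (eqa S) < K%:R / S.
Proof.
move=> KS; have a1 := equal_alpha_ge1 KS.
rewrite -u_v_equal u_epis_lt_u_v// andbT.
move: K_ge2 a1; case: K => [//|n] n0 a1; exact: u_epis_gt0.
Qed.

Lemma u_alea_equal S : K%:R <= S -> u_alea (eqa S) = 1 - u_epis (eqa S).
Proof. by move=> KS; rewrite /u_epis u_en_equal// opprB addrC subrK. Qed.

Lemma cvg_divy (x : R) : x / S @[S --> +oo] --> (0 : R).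
Proof.
rewrite -[X in _ --> X](mulr0 x); apply: cvgMr.
apply/gtr0_cvgV0; last exact: cvg_id.
exact: nbhs_pinfty_gt.
Qed.

Lemma cvg_u_epis_equal : u_epis (eqa S) @[S --> +oo] --> (0 : R).
Proof.
apply: (@squeeze_cvgr _ _ _ _ (fun=> 0) (fun S => K%:R / S)).
- near=> S; have /andP[/ltW -> /ltW ->//] : 0 < u_epis (eqa S) < K%:R / S.
  by apply: u_epis_equal; near: S; apply: nbhs_pinfty_ge.
- exact: cvg_cst.
- exact: cvg_divy.
Unshelve. all: by end_near. Qed.

Lemma cvg_u_alea_equal : u_alea (eqa S) @[S --> +oo] --> (1 : R).
Proof.
have : 1 - u_epis (eqa S) @[S --> +oo] --> (1 - 0 : R).
  by apply: cvgB; [exact: cvg_cst|exact: cvg_u_epis_equal].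
rewrite subr0; apply: cvg_trans; apply: near_eq_cvg.
have : \forall S \near +oo%R, (K%:R : R) <= S by apply: nbhs_pinfty_ge.
by apply: filterS => S KS; rewrite u_alea_equal.
Qed.

Lemma cvg_u_diss_equal : u_diss (eqa S) @[S --> +oo] --> (1 : R).
Proof.
have : 1 - K%:R / S @[S --> +oo] --> (1 - 0 : R).
  by apply: cvgB; [exact: cvg_cst|exact: cvg_divy].
rewrite subr0; apply: cvg_trans; apply: near_eq_cvg.
have : \forall S \near +oo%R, (K%:R : R) < S by apply: nbhs_pinfty_gt.
by apply: filterS => S KS; rewrite u_diss_equal.
Qed.

Lemma cvg_u_v_equal : u_v (eqa S) @[S --> +oo] --> (0 : R).
Proof.
by under eq_fun do rewrite u_v_equal; exact: cvg_divy.
Qed.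

Lemma equal_order : \forall S \near +oo,
  u_alea (eqa S) < u_en (eqa S) /\ u_diss (eqa S) < u_alea (eqa S) /\
  u_v (eqa S) < u_diss (eqa S) /\ u_epis (eqa S) < u_v (eqa S).
Proof.
have K0 := K_gt0.
(* Beyond [2 K], [u_v = K / S] is below 1/2, hence below [u_diss = 1 - K / S]; the other comparisons
   follow from [0 < u_epis < K / S]. *)
near=> S; have S2K : 2 * K%:R < S by near: S; apply: nbhs_pinfty_gt.
have KS : K%:R < S by lra.
have := u_epis_equal (ltW KS); rewrite u_alea_equal ?ltW//.
rewrite u_en_equal ?ltW// u_diss_equal// u_v_equal => /andP[e0 eK].
have : K%:R / S < 1 / 2.
  by rewrite ltr_pdivrMr; lra.
by do ![split]; lra.
Unshelve. all: by end_near. Qed.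

End EqualEvidence.

(** Here [u_en = 1], so [u_alea = 1 - u_epis] and everything reduces to [0 < u_epis < 1 / 2]. *)
Lemma one_order (R : realType) (K : nat) : (2 <= K)%N ->
  let one := fun _ : 'I_K => (1 : R) in
  u_v one = 1 /\ u_en one = 1 /\ u_alea one < u_en one /\
  u_epis one < u_alea one /\ u_diss one < u_epis one /\ u_diss one = 0.
Proof.
move=> K2 one; have enE := u_en_cst K2 (@ltr01 R); rewrite -/one in enE.
have aleaE : u_alea one = 1 - u_epis one by rewrite /u_epis enE opprB addrC subrK.
rewrite aleaE enE u_diss_one /u_v strength_cst mulr1 divff ?pnatr_eq0; last first.
  by case: K K2 {one enE aleaE}.
have [e0 e2] : 0 < u_epis one /\ u_epis one < 1 / 2.
  move: K2 @one {enE aleaE}; case: K => [//|n] n0 one; split; first exact: u_epis_gt0.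
  apply: le_lt_trans (u_epis_le n0 (fun=> lexx 1)) _; rewrite strength_cst mulr1.
  (* With [S = n + 1] the upper bound is [n / ((n + 2) L)], which is below 1/2 exactly when
     [L > 2 n / (n + 2)]. *)
  have := ln_nat_gt R n0; have n1 : 1 <= n%:R :> R by rewrite ler1n.
  rewrite -(natr1 n) -addrA; set x : R := n%:R in n1 *; set L := ln _ => H.
  have x0 : 0 < 2 * x / (x + 2) by apply: divr_gt0; lra.
  have L0 : 0 < L by lra.
  rewrite ltr_pdivrMr; last by apply: mulr_gt0; lra.
  move: H; rewrite ltr_pdivrMr; lra.
by do ![split]; lra.
Qed.

Theorem theorem1 (R : realType) (K : nat) (hK : (2 <= K)%N) :
  (* 1. for every alpha with alpha_k >= 1 *)
  (forall alpha : 'I_K -> R, (forall k, 1 <= alpha k) ->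
     u_v alpha + u_diss alpha <= 1 /\ u_epis alpha < u_v alpha)
  /\
  (* 2(a). alpha = (1, ..., 1) *)
  (let one := fun _ : 'I_K => (1 : R) in
     u_v one = 1 /\ u_en one = 1 /\ u_alea one < u_en one /\
     u_epis one < u_alea one /\ u_diss one < u_epis one /\ u_diss one = 0)
  /\
  (* 2(b). equal alphas: alpha_k = S / K *)
  ((forall a : R, 1 <= a -> u_en (fun _ : 'I_K => a) = 1)
   /\ (u_diss (@equal_alpha R K S)) @[S --> +oo] --> (1 : R)
   /\ (u_alea (@equal_alpha R K S)) @[S --> +oo] --> (1 : R)
   /\ (u_v (@equal_alpha R K S)) @[S --> +oo] --> (0 : R)
   /\ (u_epis (@equal_alpha R K S)) @[S --> +oo] --> (0 : R)
   /\ (\forall S \near +oo,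
         let alpha := @equal_alpha R K S in
         u_alea alpha < u_en alpha /\ u_diss alpha < u_alea alpha /\
         u_v alpha < u_diss alpha /\ u_epis alpha < u_v alpha)).
Proof.
have K0 := ltnW hK; split=> [alpha a1|].
  by split; [exact: u_vD_u_diss|exact: u_epis_lt_u_v].
split; first exact: one_order.
split=> [a a1|]; first by rewrite u_en_cst// (lt_le_trans ltr01).
split; first exact: cvg_u_diss_equal.
split; first exact: cvg_u_alea_equal.
split; first exact: cvg_u_v_equal.
split; first exact: cvg_u_epis_equal.
exact: equal_order.
Qed.
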